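(* Let $X$ be a Tychonoff space and let $\lambda$ be a family of subsets of $X$ which covers $X$ and satisfies: (1) if $A\in\lambda$ and $A'\subseteq A$ then $A'\in\lambda$; (2) if $A_1,A_2\in\lambda$ then $A_1\cup A_2\in\lambda$; (3) if $A\in\lambda$ then $\overline{A}\in\lambda$. Let $\sigma\lambda$ be the family of all countable unions of elements of $\lambda$. If $X$ is an $AV_{\sigma\lambda}$-space, then $C_{\lambda,\rho}(X)$ is a $\mu$-space.
   Context: **Game.** Let $X$ be a topological space, $\kappa$ a family of subsets of $X$, $A\subseteq X$ a non-closed set and $x\in\overline{A}\setminus A$. In the Asanov–Velichko game $AV_\kappa(X)$ (for $A$ and $x$), at the $n$-th step ($n\in\mathbb{N}$) player ONE chooses a neighborhood $V_n$ of $x$, and then player TWO chooses a set $S_n\subseteq A$ such that $S_n\subseteq\overline{T_n}$ for some $T_n\in\kappa$. Player TWO wins if $\overline{\bigcup_{n}S_n}\cap\bigcap_{n}V_n\neq\emptyset$; otherwise ONE wins. $X$ is an $AV_\kappa$-space if for every non-closed $A\subseteq X$ there is $x\in\overline{A}\setminus A$ for which player TWO has a winning strategy in this game. **Function space.** $C_{\lambda,\rho}(X)$ is the set $C(X,\mathbb{R})$ of continuous real-valued functions with the topology of uniform convergence on elements of $\lambda$, i.e. the topology induced by the uniformity generated by the sets $\{(f,g): |f(x)-g(x)|<\varepsilon \text{ for all } x\in A\}$, $A\in\lambda$, $\varepsilon>0$ ($\rho$ is the usual metric of $\mathbb{R}$). **$\mu$-space.** A subset $A$ of a space $Z$ is bounded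 (in $Z$) if every continuous real-valued function on $Z$ is bounded on $A$; it is relatively compact if its closure in $Z$ is compact. $Z$ is a $\mu$-space if every bounded subset of $Z$ is relatively compact. *)

(* Defs.v *)
From HB Require Import structures.
From mathcomp Require Import all_boot all_order all_algebra.
From mathcomp Require Import all_classical all_reals all_analysis.

Set Implicit Arguments.
Unset Strict Implicit.
Unset Printing Implicit Defensive.

Import Order.TTheory GRing.Theory Num.Theory.
Import numFieldNormedType.Exports.

Local Open Scope classical_set_scope.
Local Open Scope ring_scope.

Definition tychonoff_space (X : topologicalType) : Prop :=
  hausdorff_space X /\ completely_regular_space X.

(* A strategy for TWO answers the finite list [:: V_0; ...; V_n] of the moves
   of ONE so far; TWO's own earlier moves are determined by that list. Against
   every play of ONE it must make only legal moves and win. *)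
Definition AV_winning_strategy (X : topologicalType) (kappa : set (set X))
    (A : set X) (x : X) (strategy : seq (set X) -> set X) : Prop :=
  forall V : nat -> set X, (forall n, nbhs x (V n)) ->
    let S n := strategy (mkseq V n.+1) in
    (forall n, S n `<=` A /\ exists2 T, kappa T & S n `<=` closure T) /\
    (closure (\bigcup_n S n) `&` \bigcap_n V n) !=set0.

Definition AV_space (X : topologicalType) (kappa : set (set X)) : Prop :=
  forall A : set X, ~ closed A ->
    exists2 x, (closure A `\` A) x &
      exists strategy, AV_winning_strategy kappa A x strategy.

Definition sigma_family (X : Type) (lambda : set (set X)) : set (set X) :=
  [set B | exists G : set (set X),
     [/\ G `<=` lambda, countable G & B = \bigcup_(A in G) A]].

(* C(X, R) as a uniform subspace of {family lambda, X -> R}, whose uniformity is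
   the supremum of those of uniform convergence on the members of lambda *)
Definition C_unif (X : topologicalType) (R : realType)
  (lambda : set (set X)) : Type := continuousType X R.

HB.instance Definition _ (X : topologicalType) (R : realType)
    (lambda : set (set X)) :=
  Uniform.copy (C_unif R lambda)
    (@initial_topology (continuousType X R) {family lambda, X -> R} id).

Definition bounded_in (R : realType) (Z : topologicalType) (A : set Z) : Prop :=
  forall f : Z -> R, continuous f -> bounded_set (f @` A).

Definition mu_space (R : realType) (Z : topologicalType) : Prop :=
  forall A : set Z, bounded_in R A -> compact (closure A).

(* Main.v *)
(* Let F be bounded in C_lambda(X). A countable subfamily of lambda gives a
   continuous pseudometric on C_lambda(X), and bounded sets are relatively
   countably compact for continuous pseudometrics; so every sequence in F has a
   cluster point in C(X), uniformly on each of countably many given members of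
   lambda. Hence F is totally bounded on each member of lambda, and an
   ultrafilter on closure F converges, uniformly on members of lambda, to some
   g : X -> R. It remains to see that g is continuous. By the same cluster
   points, g agrees on closure T, for T in sigma lambda, with a continuous map.
   If g^-1(C) were not closed for some closed C, let ONE play against TWO's
   winning strategy at x the sets V_n = {y | |f_n(x) - f_n(y)| < 1/(n+1)}, with
   f_n in F close to g at x and on finitely many pieces of T_0, ..., T_(n-1).
   For y in the winning intersection, a cluster point h of (f_n) on x, y and all
   the T_n satisfies h(y) = g(x) and h = g on every S_n, so h maps each S_n into
   C; then g(x) = h(y) is in C, a contradiction. *)

Require Import Defs.
From mathcomp Require Import all_boot all_order all_algebra.
From mathcomp Require Import lra.
From mathcomp Require Import all_classical all_reals all_analysis.

Set Implicit Arguments.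
Unset Strict Implicit.
Unset Printing Implicit Defensive.

Import Order.TTheory GRing.Theory Num.Theory.
Import numFieldNormedType.Exports.

Local Open Scope classical_set_scope.
Local Open Scope ring_scope.

(** * Cluster points of sequences in bounded sets *)

Lemma bounded_in_pseudometric_cluster (R : realType) (Z : topologicalType)
    (d : Z -> Z -> R) (F : set Z) (f : nat -> Z) :
  (forall x y, 0 <= d x y) -> (forall x y, d x y = d y x) ->
  (forall x y z, d x z <= d x y + d y z) ->
  (forall z e, 0 < e -> \forall w \near z, d z w < e) ->
  bounded_in R F -> (forall n, F (f n)) ->
  exists z, forall e N, 0 < e -> exists2 n, (N <= n)%N & d z (f n) < e.
Proof.
move=> d_ge0 dC dT d_near bF Ff; apply: contrapT => nocluster.
have d0 z : d z z = 0.
  apply/eqP; rewrite eq_le d_ge0 andbT; apply/ler_addgt0Pl => e e0.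
  by rewrite addr0 ltW// (nbhs_singleton (d_near z e e0)).
pose E z := [set d z (f n) + n.+1%:R^-1 | n in [set: nat]].
(* [u] is positive if [f] has no cluster point, and [u (f n) <= 1 / n.+1], so
   [1 / u] is continuous and unbounded on [F]. *)
pose u z := inf (E z).
have E0 z : E z !=set0 by exists (d z (f 0%N) + 1%:R^-1); exists 0%N.
have lbE z : has_lbound (E z).
  by exists 0 => _ [n _ <-]; rewrite addr_ge0// invr_ge0.
have u_lip z w : u z <= d z w + u w.
  rewrite -lerBlDl; apply: lb_le_inf => // _ [n _ <-].
  rewrite lerBlDl addrA; apply: le_trans (_ : d z (f n) + n.+1%:R^-1 <= _).
    by apply: ge_inf => //; exists n.
  by rewrite lerD2r.
have u_cts : continuous u.
  move=> z; apply/cvgrPdist_lt => e e0; near=> w.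
  have dzw : d z w < e by near: w; exact: d_near.
  by rewrite ltr_norml; have := u_lip z w; have := u_lip w z; rewrite dC; lra.
(* From some [N] on, the distances to [z] are at least [e]; for the finitely many earlier terms the
   summand of [E z] alone exceeds [N.+1%:R^-1]. *)
have u_gt0 z : 0 < u z.
  have /existsNP[e /existsNP[N /not_implyP[e0 faraway]]] :
      ~ (forall e N, 0 < e -> exists2 n, (N <= n)%N & d z (f n) < e).
    by move=> zP; apply: nocluster; exists z.
  apply: (@lt_le_trans _ _ (Num.min e N.+1%:R^-1)).
    by rewrite lt_min e0 invr_gt0 ltr0n.
  apply: lb_le_inf => // _ [n _ <-]; rewrite ge_min.
  have [Nn|nN] := leqP N n.
    apply/orP; left; rewrite -[e]addr0 lerD ?invr_ge0// leNgt.
    by apply/negP => dlt; apply: faraway; exists n.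
  apply/orP; right; rewrite -[leLHS]add0r lerD ?d_ge0// lef_pV2 ?posrE//.
  by rewrite ler_nat ltnW.
have : continuous (fun z => (u z)^-1).
  by move=> z; apply: cvgV; [rewrite gt_eqF|exact: u_cts].
move=> /bF /pinfty_ex_gt0[M M0 uM].
have [n Mn] : exists n : nat, M < n%:R.
  by exists (Num.bound M); apply: archi_boundP; exact: ltW.
have : `|(u (f n))^-1| <= M by exact: (uM _ (imageP _ (Ff n))).
rewrite ger0_norm; last by rewrite invr_ge0 ltW.
apply/negP; rewrite -ltNge (lt_trans Mn)//.
rewrite -[ltLHS]invrK ltf_pV2 ?posrE ?u_gt0//; last first.
  by rewrite invr_gt0 (lt_trans M0).
rewrite (@le_lt_trans _ _ n.+1%:R^-1)//; last first.
  by rewrite ltf_pV2 ?posrE ?ltr_nat// (lt_trans M0).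
by apply: ge_inf => //; exists n => //; rewrite d0 add0r.
Unshelve. all: by end_near. Qed.

Lemma C_unif_nbhs (R : realType) (X : topologicalType) (lambda : set (set X))
    (f : C_unif R lambda) (A : set X) (e : R) :
  lambda A -> 0 < e ->
  nbhs f [set g : C_unif R lambda | forall a, A a -> `|f a - g a| < e].
Proof.
move=> lA e0.
have entE : entourage [set xy : R * R | `|xy.1 - xy.2| < e].
  by rewrite -entourage_ballE; exists e.
exact: (@initial_continuous _ _ (id : continuousType X R ->
  {family lambda, X -> R}) f _ (fam_nbhs f entE lA)).
Qed.

Lemma C_unif_cvg (R : realType) (X : topologicalType) (lambda : set (set X))
    (F : set_system (C_unif R lambda)) (f : C_unif R lambda) : Filter F ->
  (forall A e, lambda A -> 0 < e ->
    F [set g : C_unif R lambda | forall a, A a -> `|f a - g a| < e]) ->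
  F --> f.
Proof.
move=> FF Ff B [_ [[U oU <-] Uf UB]].
have : (id : C_unif R lambda -> (X -> R)) @ F -->
    (f : {family lambda, X -> R}).
  apply/fam_cvgP => A lA W /uniform_nbhs[E [entE EW]].
  move: entE; rewrite -entourage_ballE => -[e e0 eE].
  suff sub : [set g : C_unif R lambda | forall a, A a -> `|f a - g a| < e] `<=`
      [set g : C_unif R lambda | W g] by exact: (filterS sub (Ff A e lA e0)).
  move=> g fg; apply: (EW (g : X -> R)) => a Aa.
  exact: (eE (_, _) (fg a Aa)).
move=> cvF; apply: (filterS UB); apply: (cvF U).
by apply: open_nbhs_nbhs; split.
Qed.

Lemma minr_dist_triangle (R : realType) (w x y z : R) : 0 <= w ->
  Num.min w `|x - z| <= Num.min w `|x - y| + Num.min w `|y - z|.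
Proof.
move=> w0; have := ler_distD y x z.
have := normr_ge0 (x - y); have := normr_ge0 (y - z).
by rewrite !minElt; do 3 case: ifP => ?; lra.
Qed.

(** The uniform distances on the [B i], truncated at [i.+1%:R^-1], have as supremum a single
    pseudometric [d]. The truncation makes [d] continuous: up to a given error only finitely many
    [B i] matter. *)
Lemma bounded_in_C_unif_cluster (R : realType) (X : topologicalType)
    (lambda : set (set X)) (F : set (C_unif R lambda)) (B : nat -> set X)
    (f : nat -> C_unif R lambda) :
  bounded_in R F -> (forall i, lambda (B i)) -> (forall n, F (f n)) ->
  exists g : C_unif R lambda, forall i e N, 0 < e ->
    exists2 n, (N <= n)%N & forall a, B i a -> `|g a - f n a| < e.
Proof.
move=> bF lB Ff.
(* The value 0 keeps the set nonempty even when every [B i] is empty. *)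
pose E (h k : C_unif R lambda) := [set r : R | r = 0 \/
  exists i a, B i a /\ r = Num.min i.+1%:R^-1 `|h a - k a|].
pose d h k := sup (E h k).
have E0 h k : E h k !=set0 by exists 0; left.
have invS_ge0 i : 0 <= i.+1%:R^-1 :> R by rewrite invr_ge0.
have ubE h k : has_ubound (E h k).
  exists 1 => _ [->//|[i [a [_ ->]]]]; rewrite ge_min; apply/orP; left.
  by rewrite invf_le1 ?ltr0n// ler1n.
have d_ge0 h k : 0 <= d h k by apply: ub_le_sup => //; left.
have dE (h k : C_unif R lambda) i a :
    B i a -> Num.min i.+1%:R^-1 `|h a - k a| <= d h k.
  by move=> Bia; apply: ub_le_sup => //; right; exists i, a.
have dC h k : d h k = d k h.
  by congr sup; apply/seteqP; split => r [->|[i [a [Bia ->]]]];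
    [left|right; exists i, a; rewrite distrC|left|right; exists i, a;
     rewrite distrC].
have dT h k l : d h l <= d h k + d k l.
  apply: ge_sup => // _ [->|[i [a [Bia ->]]]]; first by rewrite addr_ge0.
  apply: le_trans (minr_dist_triangle _ (k a) _ (invS_ge0 i)) _.
  by rewrite lerD// dE.
have d_near h e : 0 < e -> \forall k \near h, d h k < e.
  move=> e0; have e20 : 0 < e / 2 by lra.
  have [N _ Ne] := near_infty_natSinv_lt (PosNum e20).
  have : nbhs h [set k : C_unif R lambda |
      forall i a, (i < N)%N -> B i a -> `|h a - k a| < e / 2].
    elim: N {Ne} => [|N IH]; first by apply: filterE => k i a; rewrite ltn0.
    apply: filterS (filterI IH (C_unif_nbhs h (lB N) e20)) => k [hk hkN] i a.
    by rewrite ltnS leq_eqVlt => /predU1P[->|/hk]; [exact: hkN|exact].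
  apply: filterS => k hk; apply: le_lt_trans (_ : e / 2 < e); last by lra.
  apply: ge_sup => // _ [->|[i [a [Bia ->]]]]; first exact: ltW.
  rewrite ge_min; have [Ni|iN] := leqP N i.
    by apply/orP; left; exact/ltW/(Ne i).
  by apply/orP; right; apply/ltW/hk/Bia.
have [g gP] := bounded_in_pseudometric_cluster d_ge0 dC dT d_near bF Ff.
exists g => i e N e0.
(* Below [i.+1%:R^-1] the truncation is inactive, so [d] bounds the true distance on [B i]. *)
have m0 : 0 < Num.min e i.+1%:R^-1 by rewrite lt_min e0 invr_gt0 ltr0n.
have [n Nn dgf] := gP _ N m0.
exists n => // a Bia; have := le_lt_trans (dE g (f n) i a Bia) dgf.
rewrite lt_min => /andP[+ dlt]; move: dlt.
by rewrite gt_min ltxx/= => dlt; rewrite min_r// ltW.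
Qed.

(** * Sequences defined from their history, and total boundedness *)

Lemma ex_course_of_values (T : Type) (next : seq T -> T) :
  exists f : nat -> T, forall n, f n = next (mkseq f n).
Proof.
pose hist n := iter n (fun s => rcons s (next s)) [::].
exists (fun n => next (hist n)) => n; congr next.
by elim: n => // n IH; rewrite mkseqS -IH.
Qed.

Lemma take_mkseq (T : Type) (f : nat -> T) (m n : nat) :
  (m <= n)%N -> take m (mkseq f n) = mkseq f m.
Proof. by move=> mn; rewrite /mkseq -map_take take_iota (minn_idPl mn). Qed.

(** Otherwise a greedy choice gives a sequence in [F] with no two terms [e]-close on [A], yet two of
    its terms lie within [e / 2] of a cluster point. *)
Lemma bounded_in_C_unif_totally_bounded (R : realType) (X : topologicalType)
    (lambda : set (set X)) (F : set (C_unif R lambda)) (A : set X) (e : R) :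
  bounded_in R F -> lambda A -> 0 < e ->
  exists s : seq (C_unif R lambda), forall f, F f ->
    exists2 g, g \in s & forall a, A a -> `|f a - g a| < e.
Proof.
move=> bF lA e0; apply: contrapT => /forallNP noseq.
have /choice[next nextP] : forall s : seq (C_unif R lambda),
    exists h : C_unif R lambda, F h /\
      forall g, g \in s -> ~ forall a, A a -> `|h a - g a| < e.
  move=> s.
  have /existsNP[f /not_implyP[Ff fs]] := noseq s.
  by exists f; split => // g gs fg; apply: fs; exists g.
have [f fE] := ex_course_of_values next.
have Ff n : F (f n) by rewrite fE; have [] := nextP (mkseq f n).
have [g gP] := bounded_in_C_unif_cluster bF (fun=> lA) Ff.
have e20 : 0 < e / 2 by lra.
have [m _ gm] := gP 0%N _ 0%N e20.
have [n mn gn] := gP 0%N _ m.+1 e20.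
have [_ /(_ (f m))] := nextP (mkseq f n); rewrite -fE; apply.
  by apply/mapP; exists m; rewrite // mem_iota.
move=> a Aa; have := ler_distD (g a) (f n a) (f m a).
by have := gm a Aa; have := gn a Aa; rewrite (distrC _ (f n a)); lra.
Qed.

(** * Agreement of a limit function with continuous maps *)

Lemma cluster_cvg_unique (R : realType) (u : nat -> R) (l l' : R) :
  (forall e N, 0 < e -> exists2 n, (N <= n)%N & `|l' - u n| < e) ->
  u @ \oo --> l -> l' = l.
Proof.
move=> l'P /cvgrPdist_lt ul; apply/eqP; rewrite -subr_eq0 -normr_le0.
apply/ler_addgt0Pl => e e0; rewrite addr0.
have e20 : 0 < e / 2 by lra.
have [N _ Nul] := ul _ e20; have [n /Nul/= lun l'un] := l'P _ N e20.
by have := ler_distD (u n) l' l; rewrite (distrC (u n)); lra.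
Qed.

(** The factor 2 leaves room for the sum of two errors [n.+1%:R^-1], as occurs at the point [y] won
    by TWO. *)
Lemma cvg_le_natSinv (R : realType) (u : nat -> R) (l : R) :
  (\forall n \near \oo, `|u n - l| <= 2 * n.+1%:R^-1) -> u @ \oo --> l.
Proof.
move=> ul; apply/cvgrPdist_lt => e e0; have e20 : 0 < e / 2 by lra.
near=> n; rewrite distrC.
have : `|u n - l| <= 2 * n.+1%:R^-1 by near: n.
have : n.+1%:R^-1 < e / 2.
  by near: n; exact: (near_infty_natSinv_lt (PosNum e20)).
by move: n.+1%:R^-1 => r; lra.
Unshelve. all: by end_near. Qed.

(** Indices that code no member of the countable family receive [set0], so finite and empty families
    are covered too. *)
Lemma sigma_family_bigcup (X : Type) (lambda : set (set X)) (T : set X) :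
  lambda set0 -> sigma_family lambda T ->
  exists2 B : nat -> set X, forall i, lambda (B i) & T = \bigcup_i B i.
Proof.
move=> l0 [G [Gl /countable_injP[k k_inj] ->]].
have /choice[B BP] : forall i, exists A,
    (G A /\ k A = i) \/ (A = set0 /\ forall A', G A' -> k A' <> i).
  move=> i.
  have [[A GA kA]|noA] := pselect (exists2 A, G A & k A = i).
    by exists A; left.
  by exists set0; right; split => // A GA kA; apply: noA; exists A.
exists B => [i|].
  by have [[/Gl]|[-> _]] := BP i.
apply/seteqP; split => a.
  move=> [A GA Aa]; exists (k A) => //.
  have [[GB kB]|[_ /(_ A GA)//]] := BP (k A).
  by rewrite (k_inj _ _ _ _ kB)// inE.
move=> [i _ Ba]; have [[GB _]|[B0 _]] := BP i; first by exists (B i).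
by rewrite B0 in Ba.
Qed.

Lemma setU_closed_bigcup (X : Type) (lambda : set (set X)) (B : nat -> set X)
    (n : nat) :
  lambda set0 ->
  (forall A1 A2, lambda A1 -> lambda A2 -> lambda (A1 `|` A2)) ->
  (forall i, lambda (B i)) -> lambda (\bigcup_(i in `I_n) B i).
Proof.
move=> l0 lU lB; elim: n => [|n IH]; first by rewrite II0 bigcup_set0.
by rewrite IIS bigcup_setU bigcup_set1; exact: lU.
Qed.

Lemma continuous_eq_closure (R : realType) (X : topologicalType) (f g : X -> R)
    (A : set X) : continuous f -> continuous g ->
  (forall x, A x -> f x = g x) -> forall x, closure A x -> f x = g x.
Proof.
move=> cf cg fg x Ax.
have cfg : continuous (f \- g).
  by move=> z; apply: continuousB; [exact: cf|exact: cg].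
have cl : closed [set z | f z - g z = 0].
  by move/continuous_closedP : cfg => /(_ [set 0]); apply; exact: closed_eq.
apply/eqP; rewrite -subr_eq0; apply/eqP.
apply: (cl : closure _ `<=` _); apply: closure_subset Ax => z /fg /= ->.
exact: subrr.
Qed.

(** Elements of [F] ever closer to [g] on growing finite unions of the [B i] converge to [g] at each
    point of every [B i]; their cluster point is [h]. *)
Lemma bounded_in_limit_eq_on (R : realType) (X : topologicalType)
    (lambda : set (set X)) (F : set (C_unif R lambda)) (g : X -> R)
    (B : nat -> set X) :
  lambda set0 ->
  (forall A1 A2, lambda A1 -> lambda A2 -> lambda (A1 `|` A2)) ->
  bounded_in R F ->
  (forall A e, lambda A -> 0 < e ->
    exists2 f, F f & forall a, A a -> `|f a - g a| < e) ->
  (forall i, lambda (B i)) ->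
  exists h : C_unif R lambda, forall i a, B i a -> h a = g a.
Proof.
move=> l0 lU bF Fg lB.
have /choice[f fP] : forall n, exists f, F f /\
    forall a, (\bigcup_(i in `I_n.+1) B i) a -> `|f a - g a| < n.+1%:R^-1.
  move=> n; have [||f Ff fg] := Fg (\bigcup_(i in `I_n.+1) B i) n.+1%:R^-1.
  - exact: setU_closed_bigcup.
  - by rewrite invr_gt0 ltr0n.
  by exists f.
have Ff n : F (f n) by have [] := fP n.
have [h hP] := bounded_in_C_unif_cluster bF lB Ff.
exists h => i a Bia; apply: (@cluster_cvg_unique _ (fun n => f n a)).
  by move=> e N e0; have [n Nn hf] := hP i e N e0; exists n => //; exact: hf.
apply: cvg_le_natSinv; exists i => // n /= iN.
have [_ /(_ a)fg] := fP n; rewrite (le_trans (ltW (fg _)))//.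
  by exists i.
by rewrite ler_peMl ?invr_ge0// ler1n.
Qed.

(** As [g] is not known to be continuous, it is replaced by a continuous [k] that equals [g] on the
    [B i] and also at [y]; then [h] and [k] agree on the closure. *)
Lemma bounded_in_limit_eq_on_closure (R : realType) (X : topologicalType)
    (lambda : set (set X)) (F : set (C_unif R lambda)) (g : X -> R)
    (B : nat -> set X) (h : X -> R) :
  lambda set0 -> (forall x, lambda [set x]) ->
  (forall A1 A2, lambda A1 -> lambda A2 -> lambda (A1 `|` A2)) ->
  bounded_in R F ->
  (forall A e, lambda A -> 0 < e ->
    exists2 f, F f & forall a, A a -> `|f a - g a| < e) ->
  (forall i, lambda (B i)) -> continuous h ->
  (forall i a, B i a -> h a = g a) ->
  forall y, closure (\bigcup_i B i) y -> h y = g y.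
Proof.
move=> l0 l1 lU bF Fg lB ch hg y By.
have [k kg] := @bounded_in_limit_eq_on _ _ _ _ g (fun i => [set y] `|` B i)
  l0 lU bF Fg (fun i => lU _ _ (l1 y) (lB i)).
rewrite -(kg 0%N); last by left.
apply: continuous_eq_closure By => //; first exact: cts_fun.
by move=> a [i _ Bia]; rewrite (hg i)// (kg i)//; right.
Qed.

(** * Continuity of the limit function by the game *)

Lemma AV_space_limit_continuous (R : realType) (X : topologicalType)
    (lambda : set (set X)) (F : set (C_unif R lambda)) (g : X -> R) :
  lambda set0 -> (forall x, lambda [set x]) ->
  (forall A1 A2, lambda A1 -> lambda A2 -> lambda (A1 `|` A2)) ->
  AV_space (sigma_family lambda) -> bounded_in R F ->
  (forall A e, lambda A -> 0 < e ->
    exists2 f, F f & forall a, A a -> `|f a - g a| < e) ->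
  continuous g.
Proof.
move=> l0 l1 lU AVX bF Fg; apply/continuous_closedP => C closedC.
apply: contrapT => /AVX[x [_ gxC] [sigma win]].
(* [E s i], i in nat, are members of lambda whose union witnesses the legality
   of TWO's answer to [s] *)
have /choice[E EP] : forall s : seq (set X), exists B : nat -> set X,
    (forall i, lambda (B i)) /\
    ((0 < size s)%N -> (forall i, nbhs x (nth setT s i)) ->
      sigma s `<=` closure (\bigcup_i B i)).
  move=> s; have [[s0 sx]|nos] := pselect ((0 < size s)%N /\
    forall i, nbhs x (nth setT s i)); last first.
    by exists (fun=> set0); split => // s0 sx; exfalso; exact: nos.
  (* Padding [s] with [setT] yields an infinite legal play of ONE, in which [sigma s] is the answer
     number [(size s).-1]. *)
  have [/(_ (size s).-1)[_ [T lT sT]] _] := win _ sx.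
  have sE : mkseq (nth setT s) (size s).-1.+1 = s by rewrite prednK// mkseq_nth.
  have [B lB TB] := sigma_family_bigcup l0 lT.
  by exists B; split => // _ _; rewrite -TB -[in sigma s]sE.
have lE s i : lambda (E s i) by have [] := EP s.
(* After the history [s], ONE controls [x] and the pieces of index at most [size s] for every prefix
   of [s]: a finite union, which in the long run catches every piece. *)
pose D (s : seq (set X)) := [set x] `|`
  \bigcup_(j in `I_(size s).+1) \bigcup_(i in `I_(size s).+1) E (take j s) i.
have lD s : lambda (D s).
  apply: (lU) => //; do 2 apply: setU_closed_bigcup => // ?.
have /choice[phi phiP] : forall s, exists f, F f /\
    forall a, D s a -> `|f a - g a| < (size s).+1%:R^-1.
  move=> s; have [|f Ff fg] := Fg _ (size s).+1%:R^-1 (lD s).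
    by rewrite invr_gt0 ltr0n.
  by exists f.
have [V VE] := ex_course_of_values (fun s : seq (set X) =>
  [set y | `|phi s x - phi s y| < (size s).+1%:R^-1]).
have Vx n : nbhs x (V n).
  have /cvgrPdist_lt := @cts_fun _ _ (phi (mkseq V n)) x.
  by rewrite VE; apply; rewrite invr_gt0 ltr0n.
pose f n := phi (mkseq V n).
have Ff n : F (f n) by have [] := phiP (mkseq V n).
have fD n a : D (mkseq V n) a -> `|f n a - g a| < n.+1%:R^-1.
  by have [_ /(_ a)] := phiP (mkseq V n); rewrite size_mkseq.
have [SA [y [Sy Vy]]] := win V Vx.
(* Decoding pairs lists all pieces [i] of all stages [j] in one sequence, so that a single [h]
   serves them all; numbers that code no pair default to [(0, 0)]. *)
pose P k : nat * nat := odflt (0, 0)%N (unpickle k).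
pose B k := [set x] `|` [set y] `|` E (mkseq V (P k).2) (P k).1.
have lB k : lambda (B k) by do 2 apply: (lU) => //.
have [h hP] := bounded_in_C_unif_cluster bF lB Ff.
have h_unique k a l : B k a -> f^~ a @ \oo --> l -> h a = l.
  move=> Bka; apply: cluster_cvg_unique => e N e0.
  by have [n Nn hf] := hP k e N e0; exists n => //; exact: hf.
have le2 n : n.+1%:R^-1 <= 2 * n.+1%:R^-1 :> R.
  by rewrite ler_peMl ?invr_ge0// ler1n.
have fx n : `|f n x - g x| < n.+1%:R^-1 by apply: fD; left.
have hE j i a : E (mkseq V j) i a -> h a = g a.
  move=> Ea; apply: (h_unique (pickle (i, j))).
    by right; rewrite /P pickleK.
  (* From [maxn i j] on, [mkseq V j] is a prefix of the history and its piece [i] lies in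
     [D (mkseq V n)]. *)
  apply: cvg_le_natSinv; exists (maxn i j) => // n /=.
  rewrite geq_max => /andP[ni nj]; apply: le_trans (le2 n); apply/ltW/fD.
  right; exists j; rewrite /= size_mkseq//.
  by exists i => //; rewrite take_mkseq.
have hy : h y = g x.
  apply: (h_unique 0%N); first by left; right.
  apply: cvg_le_natSinv; exists 0%N => // n _.
  (* Membership in [V n] bounds the distance from [f n y] to [f n x], and [fx] the one from [f n x]
     to [g x]. *)
  have : V n y by exact: Vy.
  rewrite VE/= size_mkseq -/(f n) distrC => fyx.
  have := ler_distD (f n x) (f n y) (g x); have := fx n; move: fyx.
  by move: n.+1%:R^-1 => r; lra.
have ch : continuous h := @cts_fun _ _ h.
have hS n a : sigma (mkseq V n.+1) a -> h a = g a.
  have [_ sE] := EP (mkseq V n.+1).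
  move=> /sE sa.
  apply: (@bounded_in_limit_eq_on_closure _ _ lambda F g
    (E (mkseq V n.+1)) h) => //.
    by move=> i b; exact: hE.
  apply: sa; first by rewrite size_mkseq.
  move=> i; have [iV|Vi] := ltnP i n.+1; first by rewrite nth_mkseq.
  by rewrite nth_default ?size_mkseq//; exact: filterT.
apply: gxC; rewrite /= -hy.
have clC : closed (h @^-1` C) by move/continuous_closedP : ch; apply.
apply: (clC : closure _ `<=` _); apply: closure_subset Sy => a [n _ Sa].
by rewrite /= (hS n)//; have [] := SA n => /(_ a Sa).
Qed.

(** * Convergence of ultrafilters on the closure *)

Theorem theorem4p6 (R : realType) (X : topologicalType)
    (lambda : set (set X))
    (tychonoffX : tychonoff_space X)
    (lambda_cover : \bigcup_(A in lambda) A = [set: X])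
    (lambda_sub : forall A A' : set X, lambda A -> A' `<=` A -> lambda A')
    (lambda_setU : forall A1 A2 : set X,
       lambda A1 -> lambda A2 -> lambda (A1 `|` A2))
    (lambda_closure : forall A : set X, lambda A -> lambda (closure A))
    (AVX : AV_space (sigma_family lambda)) :
  mu_space R (C_unif R lambda).
Proof.
move=> F bF; rewrite compact_ultra => U UU UF.
have lambda1 x : lambda [set x].
  have [A lA Ax] : (\bigcup_(A in lambda) A) x by rewrite lambda_cover.
  by apply: lambda_sub lA _ => _ ->.
have near_member A e : lambda A -> 0 < e -> exists h : C_unif R lambda,
    U [set k : C_unif R lambda | forall a, A a -> `|h a - k a| < e].
  move=> lA e0; have e20 : 0 < e / 2 by lra.
  have [s sP] := bounded_in_C_unif_totally_bounded bF lA e20.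
  apply: contrapT => /forallNP noh.
  (* If no such ball belongs to [U], then the complements do, hence also the set avoiding all balls
     centred at the finite net [s]. *)
  have Us (t : seq (C_unif R lambda)) :
      U [set k : C_unif R lambda | forall h, h \in t ->
      ~ forall a, A a -> `|h a - k a| < e].
    elim: t => [|h t IH]; first by apply: filterE => k h; rewrite in_nil.
    have [/noh//|Uh] := in_ultra_setVsetC
      [set k : C_unif R lambda | forall a, A a -> `|h a - k a| < e] UU.
    apply: filterS (filterI IH Uh) => k [kt kh] h'.
    by rewrite inE => /predU1P[->//|/kt].
  (* Here [k] is only in the closure of [F]; it reaches the net through a nearby [f] in [F], at the
     cost of another [e / 2]. *)
  have [k [ks Fk]] := filter_ex (filterI (Us s) UF).
  have [f [Ff kf]] := Fk _ (C_unif_nbhs k lA e20).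
  have [h hs fh] := sP f Ff; apply: (ks h hs) => a Aa.
  by apply: distm_lt_splitl (kf a Aa); rewrite distrC; exact: fh.
have ev_cvg x : cvg ((fun h : C_unif R lambda => h x) @ U).
  apply/cauchy_cvgP/cauchy_exP => e e0.
  have [h Uh] := near_member _ e (lambda1 x) e0; exists (h x).
  suff sub : [set k : C_unif R lambda | forall a, [set x] a -> `|h a - k a| < e]
      `<=` [set k : C_unif R lambda | ball (h x) e (k x)].
    exact: (filterS sub Uh).
  by move=> k; apply.
pose g x := lim ((fun h : C_unif R lambda => h x) @ U).
have Ug A e : lambda A -> 0 < e ->
    U [set k : C_unif R lambda | forall a, A a -> `|g a - k a| < e].
  move=> lA e0; have e20 : 0 < e / 2 by lra.
  have e40 : 0 < e / 4 by lra.
  have [h Uh] := near_member A _ lA e40.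
  apply: filterS (Uh) => k hk a Aa.
  have /cvgrPdist_lt/(_ _ e40) ga := ev_cvg a.
  (* The auxiliary [l] depends on [a], but [h] does not, so the bound by three errors [e / 4] is
     uniform on [A]. *)
  have [l [hl gl]] := filter_ex (filterI Uh ga).
  have := hl a Aa; have := hk a Aa; have := gl : `|g a - l a| < e / 4.
  have := ler_distD (l a) (g a) (k a); have := ler_distD (h a) (l a) (k a).
  by rewrite (distrC (l a) (h a)); lra.
have cg : continuous g.
  (* A point is introduced first because [lambda set0] is obtained from a singleton. *)
  move=> x; have l0 : lambda set0 by apply: lambda_sub (lambda1 x) _.
  move: x; apply: (AV_space_limit_continuous l0 lambda1 lambda_setU AVX bF).
  move=> A e lA e0.
  have e20 : 0 < e / 2 by lra.
  have [k [gk Fk]] := filter_ex (filterI (Ug A _ lA e20) UF).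
  have [f [Ff kf]] := Fk _ (C_unif_nbhs k lA e20).
  exists f => // a Aa; rewrite distrC.
  exact: distm_lt_split (gk a Aa) (kf a Aa).
have Ucvg : U --> (mkcts cg : C_unif R lambda) by exact: C_unif_cvg.
exists (mkcts cg : C_unif R lambda); split => //.
apply: (closed_cvg _ (@closed_closure _ F) _ _ Ucvg).
exact: UF.
Qed.
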